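(* Let $F$ be a continuous distribution function symmetric about zero, and $G$ a continuous distribution function with zero median; let $\varepsilon_n\in(0,1]$ with $\varepsilon_n\to0$ and $\mu_n>0$. The CUSUM sign test (the test based on the statistic $M$) is asymptotically powerful if either $$\sqrt{n}\,\varepsilon_n\,[1/2-G(-\mu_n)]\gg\sqrt{\log\log n},$$ or there is a sequence of reals $(x_n)$ such that $$\frac{\sqrt{n}\,\varepsilon_n\,[\bar G(x_n-\mu_n)-G(-x_n-\mu_n)]}{\sqrt{\bar F(x_n)+\varepsilon_n[\bar G(x_n-\mu_n)+G(-x_n-\mu_n)]}}\gg\sqrt{\log\log n}.$$
   Context: Testing problem: for each $n$ one observes $X_1,\dots,X_n\in\mathbb{R}$ and tests $H_0^n$: $X_1,\dots,X_n$ are i.i.d. with distribution function $F(x)$, versus $H_1^n$: $X_1,\dots,X_n$ are i.i.d. with distribution function $(1-\varepsilon_n)F(x)+\varepsilon_n G(x-\mu_n)$. Limits are as $n\to\infty$. Notation: $\bar F=1-F$, $\bar G=1-G$; $F$ symmetric about zero means $F(-x)=1-F(x)$ for all $x$; for sequences, $a_n\gg b_n$ (with $a_n,b_n>0$ for large $n$) means $b_n/a_n\to0$. CUSUM sign test: order the observations so that $|X_{(1)}|>\cdots>|X_{(n)}|$ (almost surely there are no ties), put $\xi_{(i)}=\mathrm{sign}(X_{(i)})\in\{-1,1\}$ and $S_k=\sum_{i=1}^k\xi_{(i)}$. The test rejects for large values of $M=\max_{k=1,\dots,n}S_k/\sqrt{k}$. A test based on a statistic $S$ is asymptotically powerful if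 the total variation distance between the distribution of $S$ under $H_0^n$ and its distribution under $H_1^n$ tends to its maximal value, which is $2$ with the normalization $\|P-Q\|=2\sup_A|P(A)-Q(A)|$. *)

(* Defs.v *)
From HB Require Import structures.
From mathcomp Require Import all_boot all_order all_algebra.
From mathcomp Require Import all_classical all_reals all_analysis.

Set Implicit Arguments.
Unset Strict Implicit.
Unset Printing Implicit Defensive.

Import Order.TTheory GRing.Theory Num.Theory.
Import numFieldNormedType.Exports.

Local Open Scope classical_set_scope.
Local Open Scope ring_scope.

Definition mutually_independent (R : realType) (d : measure_display)
    (T : measurableType d) (P : probability T R) (I : finType)
    (X : I -> {RV P >-> R}) : Prop :=
  forall (J : {set I}) (B : I -> set R), (forall i, measurable (B i)) ->
    (P (\bigcap_(i in [set` J]) (X i @^-1` B i)) =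
     \prod_(i in J) P (X i @^-1` B i))%E.

Definition iid_with_cdf (R : realType) (d : measure_display)
    (T : measurableType d) (P : probability T R) (I : finType)
    (X : I -> {RV P >-> R}) (H : R -> R) : Prop :=
  mutually_independent X /\ forall i r, cdf (X i) r = (H r)%:E.

Definition mixture_cdf (R : realType) (F G : R -> R) (eps mu : R) : R -> R :=
  fun x => (1 - eps) * F x + eps * G (x - mu).

(* [much_larger a b] is the relation a_n >> b_n. *)
Definition much_larger (R : realType) (a b : nat -> R) : Prop :=
  [/\ \forall n \near \oo, 0 < a n, \forall n \near \oo, 0 < b n &
      (fun n => b n / a n) @ \oo --> (0 : R)].

Definition abs_sorted (R : realType) (s : seq R) : seq R :=
  sort (fun x y => `|y| <= `|x|) s.

(* S_k. For observations with a continuous distribution function, ties in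
   absolute value (which [sort] breaks by position in s) and zero observations
   (where [Num.sg] is 0) occur with probability 0. *)
Definition sign_sum (R : realType) (s : seq R) (k : nat) : R :=
  \sum_(x <- take k (abs_sorted s)) Num.sg x.

(* The maximum over k = 1, ..., size s; the default of the iterated maximum is
   the term k = 1, so it does not affect the value when s is nonempty. *)
Definition cusum_sign (R : realType) (s : seq R) : R :=
  let ratio k := sign_sum s k / Num.sqrt k%:R in
  \big[Num.max/ratio 1%N]_(1 <= k < (size s).+1) ratio k.

Definition total_variation_dist (R : realType) (d : measure_display)
    (U : measurableType d) (P Q : set U -> \bar R) : R :=
  2 * sup [set `|fine (P A) - fine (Q A)| | A in measurable].

Definition asymptotically_powerful (R : realType) (d : nat -> measure_display)
    (T : forall n, measurableType (d n))
    (P0 P1 : forall n, probability (T n) R) (S : forall n, T n -> R) : Prop :=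
  (fun n => total_variation_dist (pushforward (P0 n) (S n))
                                 (pushforward (P1 n) (S n))) @ \oo --> (2 : R).

(* Main.v *)
Require Import Defs.
From HB Require Import structures.
From mathcomp Require Import all_boot all_order all_algebra.
From mathcomp Require Import all_classical all_reals all_analysis.
From mathcomp Require Import measurable_realfun.
From mathcomp Require Import ring lra zify.

Import Order.TTheory GRing.Theory Num.Theory.
Import numFieldNormedType.Exports.

(* The rejection threshold is t_n = 6 sqrt(log log n).

   Under H_0 the signs are uniform and independent of the absolute values, so
   S_k is a simple random walk. An optional stopping argument bounds by
   exp(-l a) the probability that the walk ever crosses a line of slope 2 l
   starting at height a. A suitable line lies below t sqrt(k) on each dyadic
   block [m, 2m], whence P(M > t) <= (1 + log_2 n) exp(-t^2 / 16), which is
   O(1 / log n) at t = t_n.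

   Under H_1, for x >= 0 let K be the number of observations with |X_i| > x and
   D the sum of their signs; then S_K = D, so that M >= D / sqrt(K). Chernoff
   bounds for D and K give P(M <= t_n) <= 2 exp(-a_n^2 / 64) as soon as the
   signal a_n at level x is at least 8 t_n. The signal at level |x| is at least
   the signal at level x, and the first condition of the theorem is, up to a
   constant, the second one at level 0. *)

Set Implicit Arguments.
Unset Strict Implicit.
Unset Printing Implicit Defensive.

Local Open Scope classical_set_scope.
Local Open Scope ring_scope.

(** * Line crossing for the simple random walk *)

(** From [1 - x <= expR (- x)] comes [expR x * (1 - x) <= 1]. The quadratic times [1 - x] equals
    [1 + x ^+ 2 * (1 - 2 * x)], which is at least 1 exactly because [x <= 1 / 2]. *)
Lemma expR_le_quadratic (R : realType) (x : R) :
  x <= 1 / 2 -> expR x <= 1 + x + 2 * x ^+ 2.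
Proof.
move=> xle.
have e1 := expR_ge1Dx (- x).
have e2 : expR x * expR (- x) = 1 by rewrite -expRD subrr expR0.
have e0 : 0 < expR x := expR_gt0 x.
have : expR x * (1 - x) <= 1 by rewrite -[leRHS]e2 ler_pM2l.
have : 0 <= x ^+ 2 * (1 - 2 * x) by rewrite mulr_ge0 ?sqr_ge0 //; lra.
have x1 : 0 < 1 - x by lra.
move=> h1 h2; rewrite -(ler_pM2r x1); apply: (le_trans h2).
suff -> : (1 + x + 2 * x ^+ 2) * (1 - x) = 1 + x ^+ 2 * (1 - 2 * x) by lra.
ring.
Qed.

(** For [l <= 1 / 2] the linear terms of the two quadratic bounds cancel. For larger [l] one has
    [l <= 2 * l ^+ 2], so each exponential is bounded separately. *)
Lemma coshR_le (R : realType) (l : R) : 0 <= l ->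
  expR l + expR (- l) <= 2 * expR (2 * l ^+ 2).
Proof.
move=> l0; have [ll|ll] := leP l (1 / 2).
  have h1 := expR_le_quadratic ll.
  have h2 : expR (- l) <= 1 + - l + 2 * (- l) ^+ 2.
    by apply: expR_le_quadratic; lra.
  rewrite sqrrN in h2.
  have h3 := expR_ge1Dx (2 * l ^+ 2).
  lra.
have h1 : expR l <= expR (2 * l ^+ 2).
  rewrite ler_expR expr2 mulrA -[leLHS]mul1r ler_wpM2r //; lra.
have h2 : expR (- l) <= expR (2 * l ^+ 2).
  rewrite ler_expR; apply: (@le_trans _ _ 0); first by rewrite oppr_le0.
  by rewrite mulr_ge0 ?sqr_ge0.
lra.
Qed.

Definition pm1 (R : realType) (b : bool) : R := if b then 1 else -1.

(** Here [a] is the current gap between the line and the walk. Each step adds the slope [c] and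
    subtracts the step, so that conditioning on the first sign leaves a problem of the same form. *)
Fixpoint crosses_line (R : realType) (c a : R) (s : seq bool) : bool :=
  (a <= 0) ||
  (if s is b :: s' then crosses_line c (a + c - pm1 R b) s' else false).

Lemma crosses_lineP (R : realType) (c a : R) (s : seq bool) (k : nat) :
  (k <= size s)%N -> a + c * k%:R <= \sum_(b <- take k s) pm1 R b ->
  crosses_line c a s.
Proof.
elim: s a k => [|b s IH] a [|k] //=; rewrite ?big_nil ?mulr0 ?addr0;
  try by move=> _ ->.
rewrite ltnS big_cons => ks h; apply/orP; right; apply: (IH _ k) => //.
by move: h; rewrite -natr1 => h; lra.
Qed.

Definition flip (I : finType) (i : I) (s : {ffun I -> bool}) :=
  [ffun j => if j == i then ~~ s j else s j].

Lemma flip_inj (I : finType) (i : I) : injective (flip i).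
Proof.
apply: (can_inj (g := flip i)) => s; apply/ffunP => j.
by rewrite !ffunE; case: eqP => // _; rewrite negbK.
Qed.

(* The induction is an optional stopping argument for the exponential
   supermartingale [exp (l S_k - 2 l^2 k)]. *)
Lemma sum_crosses_line (R : realType) (I : finType) (o : seq I) (l a : R) :
  uniq o -> 0 <= l ->
  \sum_(s : {ffun I -> bool}) (crosses_line (2 * l) a (map s o))%:R
    <= #|{ffun I -> bool}|%:R * expR (- (l * a)).
Proof.
move=> + l0; elim: o a => [|i o IH] a.
  move=> _ /=; rewrite orbF sumr_const -[leLHS]mulr_natl ler_wpM2l //.
  have [a0|a0] /= := leP a 0; last exact: expR_ge0.
  by rewrite -expR0 ler_expR oppr_ge0 mulr_ge0_le0.
rewrite cons_uniq => /andP[io uo] /=.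
have [a0|a0] /= := leP a 0.
  rewrite sumr_const -[leLHS]mulr_natl ler_wpM2l //.
  by rewrite -expR0 ler_expR oppr_ge0 mulr_ge0_le0.
pose f b (s : {ffun I -> bool}) : R :=
  (crosses_line (2 * l) (a + 2 * l - pm1 R b) (map s o))%:R.
have fE b s : f b (flip i s) = f b s.
  rewrite /f; congr (crosses_line _ _ _)%:R; apply/eq_in_map => j jo.
  by rewrite ffunE; case: eqP => // ji; move: io; rewrite -ji jo.
(* Since [i] does not occur in [o], flipping [s i] changes only the first step. Hence the sum is the
   average of the sums with the first step fixed to +1 and to -1. *)
rewrite -/(\sum_(s : {ffun I -> bool}) f (s i) s).
have e1 : \sum_(s : {ffun I -> bool}) f (s i) s =
    \sum_(s : {ffun I -> bool}) f (~~ s i) s.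
  rewrite (reindex_inj (@flip_inj _ i)) /=; apply: eq_bigr => s _.
  by rewrite fE ffunE eqxx.
have e2 : 2 * (\sum_(s : {ffun I -> bool}) f (s i) s) =
    \sum_s f true s + \sum_s f false s.
  rewrite mulr_natl mulr2n {2}e1 -!big_split /=; apply: eq_bigr => s _.
  by case: (s i) => //=; rewrite addrC.
have h1 := IH (a + 2 * l - pm1 R true) uo.
have h2 := IH (a + 2 * l - pm1 R false) uo.
(* What remains is the one-step supermartingale inequality, a rescaling of [coshR_le]. *)
suff h : expR (- (l * (a + 2 * l - pm1 R true))) +
    expR (- (l * (a + 2 * l - pm1 R false))) <= 2 * expR (- (l * a)).
  have N0 : (0 : R) <= #|{ffun I -> bool}|%:R by [].
  have := ler_wpM2l N0 h; rewrite /f in e2 *; lra.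
rewrite /pm1.
have -> : - (l * (a + 2 * l - 1)) = - (l * a) + - (2 * l ^+ 2) + l by ring.
have -> : - (l * (a + 2 * l - -1)) = - (l * a) + - (2 * l ^+ 2) + - l by ring.
rewrite !expRD -mulrDr.
apply: (le_trans (ler_wpM2l _ (coshR_le l0))).
  by rewrite mulr_ge0 ?expR_ge0.
have e : expR (- (2 * l ^+ 2)) * expR (2 * l ^+ 2) = 1.
  by rewrite -expRD addNr expR0.
by rewrite mulrCA -!mulrA e mulr1.
Qed.

Definition walk_exceeds (R : realType) (t : R) (s : seq bool) (k : nat) :=
  t * Num.sqrt k%:R < \sum_(b <- take k s) pm1 R b.

(** On the block [t * sqrt k] is at least [t * sqrt m]. The line that starts at half this height and
    reaches it at [k = 2 m] is crossed whenever the walk exceeds the curve; its half-slope times its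
    initial height is [t ^+ 2 / 16]. *)
Lemma sum_block_exceeds (R : realType) (I : finType) (o : seq I) (t : R)
    (m : nat) : uniq o -> 0 <= t -> (0 < m)%N ->
  \sum_(s : {ffun I -> bool})
    (has (fun k => [&& m <= k <= m.*2, k <= size o &
                    walk_exceeds t (map s o) k]%N) (iota 1 (size o)))%:R
    <= #|{ffun I -> bool}|%:R * expR (- (t ^+ 2 / 16)).
Proof.
move=> uo t0 m0.
have m0' : (0 : R) < m%:R by rewrite ltr0n.
pose r : R := Num.sqrt m%:R.
have r0 : 0 < r by rewrite sqrtr_gt0.
have r2 : r ^+ 2 = m%:R by rewrite sqr_sqrtr // ltW.
(* For [k <= 2 r^2] the line [t r / 2 + 2 l k] stays below [t r]. *)
pose l := t / (8 * r).
have l0 : 0 <= l by rewrite divr_ge0 // mulr_ge0 // ltW.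
apply: (@le_trans _ _ (#|{ffun I -> bool}|%:R * expR (- (l * (t * r / 2))))).
  apply: (le_trans _ (sum_crosses_line _ uo l0)); apply: ler_sum => s _.
  case: hasP => [[k _ /and3P[/andP[mk k2m] ks wk]]|_] /=; last by rewrite ler0n.
  rewrite (crosses_lineP (k := k)) ?size_map //.
  apply: (le_trans _ (ltW wk)).
  have h1 : r <= Num.sqrt k%:R by rewrite ler_sqrt ?ler_nat ?ler0n.
  apply: (le_trans _ (ler_wpM2l t0 h1)).
  have h2 : k%:R <= 2 * r ^+ 2 by rewrite r2 -natrM ler_nat mul2n.
  have h3 : 2 * l * k%:R <= 2 * l * (2 * r ^+ 2).
    by apply: ler_wpM2l h2; apply: mulr_ge0.
  apply: (le_trans (lerD (lexx _) h3)).
  suff -> : t * r / 2 + 2 * l * (2 * r ^+ 2) = t * r by [].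
  rewrite /l; field; exact: lt0r_neq0.
suff -> : l * (t * r / 2) = t ^+ 2 / 16 by [].
rewrite /l; field; exact: lt0r_neq0.
Qed.

(** A union bound over the dyadic blocks from [2 ^ j] to [2 ^ j.+1]: the index [k] lies in the block
    [j = trunc_log 2 k]. *)
Lemma sum_walk_exceeds (R : realType) (I : finType) (o : seq I) (t : R) :
  uniq o -> 0 <= t ->
  \sum_(s : {ffun I -> bool})
    (has (walk_exceeds t (map s o)) (iota 1 (size o)))%:R
    <= #|{ffun I -> bool}|%:R *
       ((trunc_log 2 (size o)).+1%:R * expR (- (t ^+ 2 / 16))).
Proof.
move=> uo t0; set J := (trunc_log 2 (size o)).+1.
rewrite mulrCA mulr_natl -[in leRHS](card_ord J) -sumr_const.
have p2 j : (0 < 2 ^ j)%N by rewrite expn_gt0.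
apply: (le_trans _ (ler_sum (index_enum 'I_J) (fun j _ =>
  @sum_block_exceeds R I o t (2 ^ j) uo t0 (p2 j)))).
rewrite exchange_big /=; apply: ler_sum => s _.
case: hasP => [[k kn wk]|_] /=; last by apply: sumr_ge0 => j _; rewrite ler0n.
move: (kn); rewrite mem_iota add1n ltnS => /andP[k1 kn'].
have jJ : (trunc_log 2 k < J)%N by rewrite ltnS leq_trunc_log.
rewrite (bigD1 (Ordinal jJ)) //= -[leLHS]addr0 lerD //; last first.
  by apply: sumr_ge0 => j _; rewrite ler0n.
rewrite (_ : has _ _ = true) //; apply/hasP; exists k => //.
rewrite wk kn' trunc_logP //= andbT -muln2 -expnSr ltnW //.
by rewrite trunc_log_ltn.
Qed.

(** * The statistic *)

Lemma lt_cusum_sign (R : realType) (s : seq R) (t : R) : (0 < size s)%N ->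
  (t < cusum_sign s) =
  has (fun k => t * Num.sqrt k%:R < sign_sum s k) (iota 1 (size s)).
Proof.
move=> s0; rewrite /cusum_sign /index_iota subn1 /=.
have kE k : (0 < k)%N ->
    (t < sign_sum s k / Num.sqrt k%:R) = (t * Num.sqrt k%:R < sign_sum s k).
  by move=> k0; rewrite ltr_pdivlMr // sqrtr_gt0 ltr0n.
apply/idP/hasP => [|[k kn tk]]; last first.
  apply: (@lt_le_trans _ _ (sign_sum s k / Num.sqrt k%:R)).
    by rewrite kE //; move: kn; rewrite mem_iota => /andP[].
  by apply: (le_bigmax_seq _ k xpredT (fun k => sign_sum s k / Num.sqrt k%:R)).
move=> tM; apply: contrapT => nk; move: tM; apply/negP; rewrite -leNgt.
have le_t k : k \in iota 1 (size s) -> sign_sum s k / Num.sqrt k%:R <= t.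
  move=> kn; rewrite leNgt kE; last by move: kn; rewrite mem_iota => /andP[].
  by apply/negP => tk; apply: nk; exists k.
rewrite big_seq; apply: bigmax_le => [|k kn]; last exact: le_t.
(* The default value of the maximum is the ratio at 1, which is in range because [s] is nonempty. *)
by apply: le_t; rewrite mem_iota; lia.
Qed.

(** Sorting indices instead of values makes the order a function of the absolute values alone, so
    that it can be separated from the signs. *)
Definition abs_order (R : realType) (n : nat) (x : 'I_n -> R) : seq 'I_n :=
  sort (fun i j => `|x j| <= `|x i|) (enum 'I_n).

Lemma sign_sum_map (R : realType) (n : nat) (x : 'I_n -> R) (k : nat) :
  sign_sum [seq x i | i <- enum 'I_n] k =
  \sum_(i <- take k (abs_order x)) Num.sg (x i).
Proof. by rewrite /sign_sum /abs_sorted sort_map -map_take big_map. Qed.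

(* A zero observation has sign 0 but is counted as a step +1, which can only
   raise the walk. *)
Lemma cusum_sign_walk (R : realType) (n : nat) (x : 'I_n -> R) (t : R) :
  (0 < n)%N -> t < cusum_sign [seq x i | i <- enum 'I_n] ->
  has (walk_exceeds t [seq 0 <= x i | i <- abs_order x]) (iota 1 n).
Proof.
move=> n0; rewrite lt_cusum_sign size_map size_enum_ord // => /hasP[k kn tk].
apply/hasP; exists k => //; rewrite /walk_exceeds; apply: (lt_le_trans tk).
rewrite sign_sum_map -map_take big_map; apply: ler_sum => i _.
by rewrite /pm1; case: sgrP => // [->|/ltW ->|] //; case: ifP.
Qed.

(** Once an entry fails to exceed [x] in absolute value, so do all later ones; the large entries
    thus form a prefix. *)
Lemma take_count_sorted (R : realType) (s : seq R) (x : R) :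
  sorted (fun x y => `|y| <= `|x|) s ->
  take (count (fun y => x < `|y|) s) s = [seq y <- s | x < `|y|].
Proof.
elim: s => //= a s IH ps.
have tr : transitive (fun x y : R => `|y| <= `|x|).
  by move=> y z w h1 h2; apply: le_trans h2 h1.
have [xa|ax] /= := ltP x `|a|; first by rewrite IH ?(path_sorted ps).
have : all (fun y => ~~ (x < `|y|)) s.
  apply/allP => y ys; rewrite -leNgt.
  by have /allP/(_ _ ys) h := order_path_min tr ps; apply: le_trans h ax.
move=> h; rewrite (eq_in_count (a2 := pred0)) ?count_pred0 ?take0; last first.
  by move=> y /(allP h) /negbTE.
rewrite (eq_in_filter (a2 := pred0)) ?filter_pred0 //.
by move=> y /(allP h) /negbTE.
Qed.

(** The statistic is bounded below by its ratio at the random index [k] that counts the observations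
    beyond the level [x]; there the partial sum is the sum of their signs. *)
Lemma lt_cusum_sign_threshold (R : realType) (n : nat) (y : 'I_n -> R)
    (x t : R) :
  t * Num.sqrt (\sum_(i < n) (x < `|y i|)%R%:R) <
    \sum_(i < n | x < `|y i|) Num.sg (y i) ->
  t < cusum_sign [seq y i | i <- enum 'I_n].
Proof.
set s := [seq y i | i <- enum 'I_n]; set k := count (fun y => x < `|y|) s.
have -> : \sum_(i < n) (x < `|y i|)%R%:R = k%:R :> R.
  rewrite -natr_sum /k count_map -sum1_count big_enum_cond /=.
  by congr _%:R; rewrite [RHS]big_mkcond; apply: eq_bigr => i _; case: ifP.
have -> : \sum_(i < n | x < `|y i|) Num.sg (y i) = sign_sum s k.
  rewrite /sign_sum /k -(count_sort (fun x y => `|y| <= `|x|)).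
  rewrite take_count_sorted; last first.
    by apply: sort_sorted => u v; apply: le_total.
  rewrite big_filter (perm_big s) ?perm_sort //= big_map big_enum_cond /=.
  by apply: eq_bigl => i; rewrite ?inE.
(* With no observation beyond [x] the hypothesis reads [0 < 0]. *)
have [->|k0 tk] := posnP k.
  by rewrite /sign_sum take0 big_nil sqrtr0 mulr0 ltxx.
have kn : (k <= size s)%N by exact: count_size.
rewrite lt_cusum_sign ?(leq_trans k0) //; apply/hasP; exists k => //.
by rewrite mem_iota; lia.
Qed.

(** * Finite-valued functions of an independent sample *)

(** The event is a finite union over the patterns in [A], each pattern being a finite intersection
    over coordinates. *)
Lemma measurable_ffun_preimage (d : measure_display) (T : measurableType d)
    (I C : finType) (c : I -> T -> C) :
  (forall i a, measurable [set w | c i w = a]) ->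
  forall A : set {ffun I -> C}, measurable [set w | A [ffun i => c i w]].
Proof.
move=> mc A.
have -> : [set w | A [ffun i => c i w]] =
    \bigcup_(z in A) \bigcap_(i in [set: I]) [set w | c i w = z i].
  apply/seteqP; split => [w /= Aw|w [z Az zw] /=].
    by exists [ffun i => c i w] => // i _ /=; rewrite ffunE.
  by rewrite (_ : [ffun i => c i w] = z) //; apply/ffunP => i; rewrite ffunE zw.
apply: fin_bigcup_measurable => [|z _]; first exact: finite_finset.
by apply: fin_bigcap_measurable => [|i _]; [exact: finite_finset|exact: mc].
Qed.

Lemma probability_finite_sum (R : realType) (d : measure_display)
    (T : measurableType d) (P : probability T R) (Z : finType) (f : T -> Z)
    (Q : pred Z) :
  (forall z, measurable [set w | f w = z]) ->
  P [set w | Q (f w)] = (\sum_(z | Q z) P [set w | f w = z])%E.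
Proof.
move=> mf.
suff H (s : seq Z) : uniq s ->
    measurable [set w | f w \in s] /\
    P [set w | f w \in s] = (\sum_(z <- s) P [set w | f w = z])%E.
  have [_] := H (enum Q) (enum_uniq _).
  rewrite big_enum => <-; congr (P _).
  by apply/seteqP; split => w /=; rewrite mem_enum.
elim: s => [|z s IH] /=.
  have -> : [set w | f w \in [::]] = set0 by apply/seteqP; split.
  by rewrite big_nil measure0.
move=> /andP[zs /IH[ms Ps]].
have -> : [set w | f w \in z :: s] = [set w | f w = z] `|` [set w | f w \in s].
  apply/seteqP; split => w /=; rewrite inE.
    by case/orP => [/eqP|] ?; [left|right].
  by case=> [->|->]; rewrite ?eqxx ?orbT.
split; first exact: measurableU.
rewrite big_cons -Ps; apply: measureU => //.
apply/seteqP; split => // w /= [-> zs']; by rewrite zs' in zs.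
Qed.

(** The Chernoff method: Markov's inequality for the product of the weights, whose expectation
    factorizes by independence. Discretizing through [c] turns this expectation into a finite
    sum. *)
Lemma iid_markov (R : realType) (d : measure_display) (T : measurableType d)
    (P : probability T R) (I C : finType) (X : I -> {RV P >-> R}) (c : R -> C)
    (p w : C -> R) (A : set T) :
  mutually_independent X ->
  (forall a, measurable (c @^-1` [set a])) ->
  (forall i a, P (X i @^-1` (c @^-1` [set a])) = (p a)%:E) ->
  (forall a, 0 <= w a) -> measurable A ->
  (forall v, A v -> 1 <= \prod_i w (c (X i v))) ->
  (P A <= ((\sum_a p a * w a) ^+ #|I|)%:E)%E.
Proof.
move=> indX mc pE w0 mA Aw.
have mcX i a : measurable [set v | c (X i v) = a].
  by have := measurable_funPT (X i) measurableT _ (mc a); rewrite setTI.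
pose f v := [ffun i => c (X i v)].
pose Q (z : {ffun I -> C}) := 1 <= \prod_i w (z i).
have p0 (i : I) a : 0 <= p a by rewrite -lee_fin -(pE i) measure_ge0.
have mQ (B : set {ffun I -> C}) : measurable [set v | B (f v)].
  exact: (@measurable_ffun_preimage _ _ _ _ (fun i v => c (X i v))).
apply: (@le_trans _ _ (P [set v | Q (f v)])).
  apply: le_measure; rewrite ?inE //; first exact: (mQ [set z | Q z]).
  move=> v /Aw /=; rewrite /Q.
  under eq_bigr do rewrite -(ffunE (fun i => c (X i v))).
  by [].
rewrite probability_finite_sum; last by move=> z; exact: (mQ [set z]).
have fE z : P [set v | f v = z] = (\prod_i p (z i))%:E.
  have := indX [set: I]%SET (fun i => c @^-1` [set z i]) (fun i => mc _).
  rewrite -prodEFin (eq_bigr (fun i => (p (z i))%:E)) => [|i _]; last exact: pE.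
  rewrite (eq_bigl xpredT) => [<-|i]; last by rewrite inE.
  congr (P _); apply/seteqP; split => v /=.
    by move=> <- i _ /=; rewrite ffunE.
  by move=> h; apply/ffunP => i; rewrite ffunE h //= inE.
rewrite (eq_bigr _ (fun z _ => fE z)) sumEFin lee_fin.
(* The power of the sum expands into a sum over all patterns, compared term by term with the
   probabilities of the patterns in [Q]. *)
rewrite -prodr_const (eq_bigl xpredT) // bigA_distr_bigA /= big_mkcond /=.
apply: ler_sum => z _; rewrite big_split /=.
have pp : 0 <= \prod_i p (z i) by apply: prodr_ge0 => i _; exact: p0.
have ww : 0 <= \prod_i w (z i) by exact: prodr_ge0.
case: ifP => [Qz|_]; last exact: mulr_ge0.
by rewrite -[leLHS]mulr1 ler_wpM2l.
Qed.

(** * Interval probabilities under a continuous distribution function *)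

Section continuous_cdf.
Variables (R : realType) (d : measure_display) (T : measurableType d).
Variables (P : probability T R) (X : {RV P >-> R}) (H : R -> R).
Hypotheses (cdfX : forall r, cdf X r = (H r)%:E) (cH : continuous H).

Let mX (B : set R) : measurable B -> measurable (X @^-1` B).
Proof.
by move=> mB; have := measurable_funPT X measurableT _ mB; rewrite setTI.
Qed.

Lemma probability_le r : P (X @^-1` `]-oo, r]) = (H r)%:E.
Proof. exact: cdfX. Qed.

Lemma probability_gt r : P (X @^-1` `]r, +oo[) = (1 - H r)%:E.
Proof.
have -> : X @^-1` `]r, +oo[ = ~` (X @^-1` `]-oo, r]).
  by rewrite preimage_setC setCitvl.
by rewrite probability_setC ?probability_le ?EFinB //; exact: mX.
Qed.

(** There is no atom at [r]: the probability is at least [H y] for every [y < r], and [H y] tends to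
    [H r]. *)
Lemma probability_lt r : P (X @^-1` `]-oo, r[) = (H r)%:E.
Proof.
apply/eqP; rewrite eq_le; apply/andP; split.
  rewrite -probability_le le_measure ?inE //; try exact: mX.
  by apply: preimage_subset => y /=; rewrite !in_itv /= => /ltW.
have fP : P (X @^-1` `]-oo, r[) \is a fin_num by exact: fin_num_measure (mX _).
rewrite -(fineK fP) lee_fin.
apply: (cvgr_to_le (cvg_at_left_filter (@cH r))).
near=> y.
rewrite -lee_fin fineK // -probability_le le_measure ?inE //; try exact: mX.
apply: preimage_subset => z /=; rewrite !in_itv /= => zy.
apply: (le_lt_trans zy); near: y; exact: nbhs_left_lt.
Unshelve. all: by end_near. Qed.

Lemma probability_itvcc a b : a <= b ->
  P (X @^-1` `[a, b]) = (H b - H a)%:E.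
Proof.
move=> ab; have : P (X @^-1` `]-oo, b]) =
    (P (X @^-1` `]-oo, a[) + P (X @^-1` `[a, b]))%E.
  rewrite -measureU; try exact: mX.
    rewrite -preimage_setU; congr (P (_ @^-1` _)); apply/seteqP.
    split => y /=; rewrite !in_itv /=.
      by have [ya|ya] := ltP y a; [left|right].
    by case=> [/ltW ya|/andP[]] //; exact: le_trans ab.
  rewrite -preimage_setI (_ : _ `&` _ = set0) ?preimage_set0 //.
  by apply/seteqP; split => y //=; rewrite !in_itv /= => -[ya /andP[]];
    rewrite leNgt ya.
rewrite probability_le probability_lt => e.
have fP : P (X @^-1` `[a, b]) \is a fin_num by exact: fin_num_measure (mX _).
by move: e; rewrite -(fineK fP) -EFinD => -[->]; rewrite addrAC subrr add0r.
Qed.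

Lemma probability_itvco a b : a <= b ->
  P (X @^-1` `[a, b[) = (H b - H a)%:E.
Proof.
move=> ab; have : P (X @^-1` `]-oo, b[) =
    (P (X @^-1` `]-oo, a[) + P (X @^-1` `[a, b[))%E.
  rewrite -measureU; try exact: mX.
    rewrite -preimage_setU; congr (P (_ @^-1` _)); apply/seteqP.
    split => y /=; rewrite !in_itv /=.
      by have [ya|ya] := ltP y a; [left|right].
    by case=> [ya|/andP[]] //; exact: lt_le_trans ab.
  rewrite -preimage_setI (_ : _ `&` _ = set0) ?preimage_set0 //.
  by apply/seteqP; split => y //=; rewrite !in_itv /= => -[ya /andP[]];
    rewrite leNgt ya.
rewrite !probability_lt => e.
have fP : P (X @^-1` `[a, b[) \is a fin_num by exact: fin_num_measure (mX _).
by move: e; rewrite -(fineK fP) -EFinD => -[->]; rewrite addrAC subrr add0r.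
Qed.

End continuous_cdf.

(** * The null hypothesis *)

(** The statistic is a function of finitely many measurable booleans: the comparisons of absolute
    values, and the positivity and negativity of each observation. *)
Lemma measurable_cusum_sign (R : realType) (d : measure_display)
    (T : measurableType d) (n : nat) (X : 'I_n -> T -> R) (A : set R) :
  (forall i, measurable_fun setT (X i)) ->
  measurable [set w | A (cusum_sign [seq X i w | i <- enum 'I_n])].
Proof.
move=> mX.
pose c (k : 'I_n * 'I_n + ('I_n + 'I_n)) (w : T) : bool :=
  match k with
  | inl (i, j) => `|X j w| <= `|X i w|
  | inr (inl i) => 0 < X i w
  | inr (inr i) => X i w < 0
  end.
have mXE i (B : set R) : measurable B -> measurable [set w | B (X i w)].
  by move=> mB; have := mX i measurableT _ mB; rewrite setTI.
have mc k a : measurable [set w | c k w = a].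
  have mT : measurable [set w | c k w].
    case: k => [[i j]|[i|i]] /=.
    - have : measurable_fun setT (fun w => `|X i w| - `|X j w|).
        by apply: measurable_funB;
          apply: (measurableT_comp (@normr_measurable R setT)).
      move=> /(_ measurableT _ (measurable_itv `[0, +oo[)); rewrite setTI.
      congr measurable; apply/seteqP; split => w /=;
        by rewrite in_itv /= andbT subr_ge0.
    - have := mXE i _ (measurable_itv `]0, +oo[).
      by congr measurable; apply/seteqP; split => w /=; rewrite in_itv /= andbT.
    - have := mXE i _ (measurable_itv `]-oo, 0[).
      by congr measurable; apply/seteqP; split => w /=; rewrite in_itv.
  case: a => //.
  have -> : [set w | c k w = false] = ~` [set w | c k w].
    by apply/seteqP; split => w /=; case: (c k w).
  exact: measurableC.
pose sgp (f : {ffun 'I_n * 'I_n + ('I_n + 'I_n) -> bool}) i : R :=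
  (f (inr (inl i)))%:R - (f (inr (inr i)))%:R.
pose op (f : {ffun 'I_n * 'I_n + ('I_n + 'I_n) -> bool}) :=
  sort (fun i j => f (inl (i, j))) (enum 'I_n).
pose rp f k := (\sum_(i <- take k (op f)) sgp f i) / Num.sqrt k%:R.
pose M f : R := \big[Num.max/rp f 1%N]_(1 <= k < n.+1) rp f k.
suff ME w : cusum_sign [seq X i w | i <- enum 'I_n] = M [ffun k => c k w].
  have -> : [set w | A (cusum_sign [seq X i w | i <- enum 'I_n])] =
      [set w | (M @^-1` A) [ffun k => c k w]].
    by apply/seteqP; split => w /=; rewrite ME.
  exact: measurable_ffun_preimage.
have opE : op [ffun k => c k w] = abs_order (X^~ w).
  rewrite /op /abs_order; congr (sort _ _).
  by apply/funext => i; apply/funext => j; rewrite ffunE.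
have rE k : sign_sum [seq X i w | i <- enum 'I_n] k / Num.sqrt k%:R =
    rp [ffun k => c k w] k.
  rewrite /rp opE sign_sum_map; congr (_ / _); apply: eq_bigr => i _.
  by rewrite /sgp !ffunE /=; case: sgrP => ?; rewrite ?subr0 ?sub0r.
rewrite /cusum_sign size_map size_enum_ord /M rE.
by apply: eq_bigr => k _; rewrite rE.
Qed.

Section symmetric_null.
Variables (R : realType) (F : R -> R).
Hypotheses (cF : continuous F) (symF : forall x, F (- x) = 1 - F x).
Variables (d : measure_display) (T : measurableType d) (P : probability T R).

(** The radius is extended so that [+oo] leaves a coordinate unconstrained. *)
Let B (rho : \bar R) : set R := [set y | (`|y|%:E <= rho)%E].
Let S (b : bool) : set R := [set y | (0 <= y) = b].

Let mB rho : measurable (B rho).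
Proof.
case: rho => [r||].
- have -> : B r%:E = `[- r, r]%classic; last exact: measurable_itv.
  by apply/seteqP; split => y; rewrite /B /= in_itv /= lee_fin ler_norml.
- have -> : B +oo%E = setT; last exact: measurableT.
  by apply/seteqP; split => y //= _; exact: leey.
- have -> : B -oo%E = set0; last exact: measurable0.
  by apply/seteqP; split => y //=; rewrite /B /= leeNy_eq.
Qed.

Let mS b : measurable (S b).
Proof.
case: b.
  have -> : S true = `[0, +oo[%classic; last exact: measurable_itv.
  by apply/seteqP; split => y; rewrite /S /= in_itv /= andbT.
have -> : S false = `]-oo, 0[%classic; last exact: measurable_itv.
apply/seteqP; split => y; rewrite /S /= in_itv /= ltNge; first by move=> ->.
by move/negbTE.
Qed.

(** The sign of one observation is fair and independent of its absolute value: by symmetry and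
    continuity [[0, r]] and [[-r, 0[] both have mass [F r - 1/2]. Counting zero as positive is
    harmless, as it has probability 0. *)
Lemma probability_abs_sign (X : {RV P >-> R}) (rho : \bar R) (b : bool) :
  (forall r, cdf X r = (F r)%:E) ->
  P (X @^-1` (B rho `&` S b)) = (2^-1%:E * P (X @^-1` B rho))%E.
Proof.
move=> cdfX.
have F0 : F 0 = 2^-1 by have := symF 0; rewrite oppr0 => ?; lra.
have mX C : measurable C -> measurable (X @^-1` C).
  by move=> mC; have := measurable_funPT X measurableT _ mC; rewrite setTI.
have B0 C : C = set0 -> P (X @^-1` C) = 0%E.
  by move=> ->; rewrite preimage_set0 measure0.
case: rho => [r||].
- have [r0|r0] := ltP r 0.
    have e : B r%:E = set0.
      apply/seteqP; split => y //=; rewrite /B /= lee_fin => yr.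
      by have := le_lt_trans yr r0; rewrite normr_lt0.
    by rewrite e set0I !B0 // mule0.
  have -> : B r%:E = `[- r, r]%classic.
    by apply/seteqP; split => y; rewrite /B /= in_itv /= lee_fin ler_norml.
  rewrite (probability_itvcc cdfX) //; last lra.
  rewrite symF -EFinM; case: b.
    have -> : `[- r, r]%classic `&` S true = `[0, r]%classic.
      apply/seteqP; split => y; rewrite /S /= !in_itv /=.
        by move=> [/andP[_ ->] ->].
      by move=> /andP[y0 ->]; rewrite y0; split => //; rewrite andbT; lra.
    by rewrite (probability_itvcc cdfX) // F0; congr EFin; lra.
  have -> : `[- r, r]%classic `&` S false = `[- r, 0[%classic.
    apply/seteqP; split => y; rewrite /S /= !in_itv /=.
      by move=> [/andP[-> _] /negbT]; rewrite -ltNge.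
    move=> /andP[ry y0]; split; last by rewrite leNgt y0.
    by rewrite ry /=; lra.
  rewrite (probability_itvco cdfX) //; last lra.
  by rewrite F0 symF; congr EFin; lra.
- have -> : B +oo%E = setT.
    by apply/seteqP; split => y //= _; exact: leey.
  rewrite setTI preimage_setT probability_setT mule1.
  have SF : S false = `]-oo, 0[%classic.
    apply/seteqP; split => y; rewrite /S /= in_itv /= ltNge; first by move=> ->.
    by move/negbTE.
  have PF : P (X @^-1` S false) = (2^-1)%:E.
    by rewrite SF (probability_lt cdfX) // F0.
  case: b => //.
  have -> : S true = ~` S false.
    by apply/seteqP; split => y; rewrite /S /=; case: (0 <= y).
  rewrite -preimage_setC probability_setC ?PF; last exact: mX.
  by rewrite -EFinB; congr EFin; lra.
- have e : B -oo%E = set0.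
    by apply/seteqP; split => y //=; rewrite /B /= leeNy_eq.
  by rewrite e set0I !B0 // mule0.
Qed.

Variables (n : nat) (X : 'I_n -> {RV P >-> R}).
Hypothesis iidX : iid_with_cdf X F.

(** A pi-system generating the sigma-algebra of the absolute values. *)
Definition abs_boxes : set (set T) :=
  [set A | exists r : 'I_n -> \bar R, A = [set w | forall i, B (r i) (X i w)]].

Let mX i C : measurable C -> measurable (X i @^-1` C).
Proof.
by move=> mC; have := measurable_funPT (X i) measurableT _ mC; rewrite setTI.
Qed.

Let sgn w := [ffun i => 0 <= X i w].

Let msgn s : measurable [set w | sgn w = s].
Proof.
apply: (@measurable_ffun_preimage _ _ _ _ (fun i w => 0 <= X i w) _ [set s]).
move=> i a; exact: (mX i (mS a)).
Qed.

(* Both sides are finite measures of [E], so it suffices to compare them on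
   boxes. *)
Lemma probability_signs (E : set T) (s : {ffun 'I_n -> bool}) :
  <<s abs_boxes >> E ->
  P (E `&` [set w | sgn w = s]) = ((2^-1 ^+ n)%:E * P E)%E.
Proof.
have [indX cdfX] := iidX.
have c0 : 0 <= 2^-1 ^+ n :> R by apply: exprn_ge0; rewrite invr_ge0.
have boxE (C : 'I_n -> set R) : (forall i, measurable (C i)) ->
    P [set w | forall i, C i (X i w)] = (\prod_i P (X i @^-1` C i))%E.
  move=> mC; have := indX [set: 'I_n]%SET C mC.
  rewrite (eq_bigl xpredT) => [<-|i]; last by rewrite inE.
  congr (P _); apply/seteqP; split => v /=.
    by move=> h i _ /=.
  by move=> h i; apply: h; rewrite /= inE.
have mbox (r : 'I_n -> \bar R) : measurable [set w | forall i, B (r i) (X i w)].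
  have -> : [set w | forall i, B (r i) (X i w)] =
      \bigcap_(i in [set: 'I_n]) (X i @^-1` B (r i)).
    by apply/seteqP; split => w /= h i; [move=> _|]; apply: h.
  by apply: fin_bigcap_measurable => // i _; exact: mX.
apply: (@g_sigma_algebra_measure_unique _ _ _ abs_boxes _ (fun=> setT) _ _
  (mrestr P (msgn s)) (mscale (NngNum c0) P)).
- by move=> _ [r ->]; exact: mbox.
- by move=> _; exists (fun=> +oo%E); apply/seteqP; split => w //= _ i; exact: leey.
- by apply/seteqP; split => w //= _; exists 0%N.
- move=> _ _ [r1 ->] [r2 ->]; exists (fun i => Order.min (r1 i) (r2 i)).
  apply/seteqP; split => w /=; rewrite /B /=.
    by move=> [h1 h2] i; rewrite le_min h1 h2.
  by move=> h; split => i; have := h i; rewrite le_min => /andP[].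
- move=> _ [r ->]; rewrite -[LHS]/(P (_ `&` _)) -[RHS]/(_ * P _)%E.
  have -> : [set w | forall i, B (r i) (X i w)] `&` [set w | sgn w = s] =
      [set w | forall i, (B (r i) `&` S (s i)) (X i w)].
    apply/seteqP; split => w /=.
      by move=> [h <-] i; split; [exact: h|rewrite /S /= ffunE].
    move=> h; split => [i|]; first by have [] := h i.
    by apply/ffunP => i; rewrite ffunE; have [] := h i.
  rewrite (boxE (fun i => B (r i) `&` S (s i))) => [|i]; last exact: measurableI.
  rewrite (boxE (fun i => B (r i))) => [|i]; last exact: mB.
  have fE i : P (X i @^-1` B (r i)) = (fine (P (X i @^-1` B (r i))))%:E.
    by rewrite fineK //; exact: fin_num_measure (mX i (mB _)).
  under eq_bigr => i _ do rewrite (probability_abs_sign _ _ (cdfX i)) fE -EFinM.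
  under [in RHS]eq_bigr => i _ do rewrite fE.
  by rewrite !prodEFin -EFinM big_split /= prodr_const card_ord.
- by move=> _; rewrite -[X in (X < _)%E]/(P (_ `&` _)) ltey_eq setTI
    fin_num_measure //; exact: msgn.
Qed.

(** The ranking depends on absolute values only: a strict comparison of two of them is witnessed by
    a rational in between, hence is a countable union of events built from boxes. *)
Lemma measurable_abs_rel (o : {ffun 'I_n * 'I_n -> bool}) :
  <<s abs_boxes >> [set w | [ffun ij => `|X ij.2 w| <= `|X ij.1 w|] = o].
Proof.
pose T' := g_sigma_algebraType abs_boxes.
have mbox i (q : R) : measurable ([set w | `|X i w| <= q] : set T').
  apply: sub_sigma_algebra; exists (fun j => if j == i then q%:E else +oo%E).
  apply/seteqP; split => w /=; rewrite /B /=.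
    by move=> h j; case: eqP => [->|_]; rewrite ?leey ?lee_fin.
  by move=> /(_ i); rewrite eqxx lee_fin.
have mlt i j : measurable ([set w | `|X i w| < `|X j w|] : set T').
  have -> : [set w | `|X i w| < `|X j w|] = \bigcup_(q in [set: rat])
      ([set w | `|X i w| <= ratr q] `&` ~` [set w | `|X j w| <= ratr q]).
    apply/seteqP; split => w /=.
      move=> /rat_in_itvoo[q]; rewrite in_itv /= => /andP[h1 h2].
      by exists q => //=; split; [exact: ltW|apply/negP; rewrite -ltNge].
    by move=> [q _ [h1 /negP]] /=; rewrite -ltNge; exact: le_lt_trans.
  apply: bigcupT_measurable_rat => q.
  by apply: measurableI; [exact: mbox|apply: measurableC; exact: mbox].
apply: (@measurable_ffun_preimage _ T' _ _
  (fun ij w => `|X ij.2 w| <= `|X ij.1 w|) _ [set o]) => -[i j] a /=.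
case: a.
  have -> : [set w | (`|X j w| <= `|X i w|) = true] =
      ~` [set w | `|X i w| < `|X j w|].
    apply/seteqP; split => w /=; first by move=> h; apply/negP; rewrite -leNgt.
    by move/negP; rewrite -leNgt.
  by apply: measurableC; exact: mlt.
have -> : [set w | (`|X j w| <= `|X i w|) = false] =
    [set w | `|X i w| < `|X j w|].
  by apply/seteqP; split => w /=; rewrite ltNge; [move=> ->|move/negbTE].
exact: mlt.
Qed.

(** Given the comparison pattern [rel], the signs are uniform, so the bound that counts sign
    patterns applies along the order determined by [rel]; then one sums over [rel]. *)
Lemma cusum_sign_null_tail (t : R) : (0 < n)%N -> 0 <= t ->
  (P [set w | (t < cusum_sign [seq X i w | i <- enum 'I_n])%R] <=
   ((trunc_log 2 n).+1%:R * expR (- (t ^+ 2 / 16)))%:E)%E.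
Proof.
move=> n0 t0.
have c0 : 0 <= 2^-1 ^+ n :> R by apply: exprn_ge0; rewrite invr_ge0.
pose rel w : {ffun 'I_n * 'I_n -> bool} :=
  [ffun ij => `|X ij.2 w| <= `|X ij.1 w|].
pose ord (r : {ffun 'I_n * 'I_n -> bool}) :=
  sort (fun i j => r (i, j)) (enum 'I_n).
pose Q (z : {ffun 'I_n * 'I_n -> bool} * {ffun 'I_n -> bool}) :=
  has (walk_exceeds t [seq z.2 i | i <- ord z.1]) (iota 1 n).
have mrel r : measurable [set w | rel w = r].
  (* Boxes are measurable in [T], hence so is the sigma-algebra that they generate. *)
  apply: (smallest_sub _ _ (measurable_abs_rel r)).
    exact: sigma_algebra_measurable.
  move=> _ [rho ->].
  have -> : [set w | forall i, B (rho i) (X i w)] =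
      \bigcap_(i in [set: 'I_n]) (X i @^-1` B (rho i)).
    by apply/seteqP; split => w /= h i; [move=> _|]; apply: h.
  by apply: fin_bigcap_measurable => // i _; exact: mX.
have mpat z : measurable [set w | (rel w, sgn w) = z].
  have -> : [set w | (rel w, sgn w) = z] =
      [set w | rel w = z.1] `&` [set w | sgn w = z.2].
    by case: z => r s; apply/seteqP; split => w /= [-> ->].
  exact: measurableI.
have Psum (P' : pred _) := @probability_finite_sum R d T P _ _ P' mpat.
apply: (@le_trans _ _ (P [set w | Q (rel w, sgn w)])).
  apply: le_measure; rewrite ?inE.
  - apply: (@measurable_cusum_sign _ _ _ _ (fun i => X i : T -> R)
      [set m | t < m]) => i; exact: measurable_funPT.
  - have -> : [set w | Q (rel w, sgn w)] = \bigcup_(z in [set z | Q z])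
        [set w | (rel w, sgn w) = z].
      by apply/seteqP; split => w /=; [exists (rel w, sgn w)|move=> [z Qz ->]].
    by apply: fin_bigcup_measurable => //; exact: finite_finset.
  - move=> w /= /(cusum_sign_walk n0); rewrite /Q /= /ord.
    have -> : sort (fun i j => rel w (i, j)) (enum 'I_n) = abs_order (X^~ w).
      rewrite /abs_order; congr (sort _ _).
      by apply/funext => i; apply/funext => j; rewrite ffunE.
    by rewrite (eq_map (g := fun i => 0 <= X i w)) // => i; rewrite ffunE.
rewrite Psum.
pose p r := fine (P [set w | rel w = r]).
have pE r : P [set w | rel w = r] = (p r)%:E.
  by rewrite fineK //; exact: fin_num_measure (mrel r).
have PE z : P [set w | (rel w, sgn w) = z] = (2^-1 ^+ n * p z.1)%:E.
  rewrite EFinM -pE -(probability_signs z.2 (measurable_abs_rel z.1)).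
  by congr (P _); case: z => r s; apply/seteqP; split => w /= [<- <-].
have p1 : \sum_r p r = 1.
  have := @probability_finite_sum R d T P _ rel xpredT mrel.
  rewrite (_ : [set w | _] = setT) ?probability_setT; last exact/seteqP.
  by under eq_bigr do rewrite pE; rewrite sumEFin => -[].
under eq_bigr do rewrite PE.
set beta := _ * expR _.
rewrite sumEFin lee_fin big_mkcond /=.
rewrite -(pair_bigA _ (fun r s => if Q (r, s) then 2^-1 ^+ n * p r else 0)) /=.
rewrite -[leRHS]mul1r -[X in _ <= X * _]p1 mulr_suml; apply: ler_sum => r _.
have p0 : 0 <= p r by rewrite fine_ge0.
have so : size (ord r) = n by rewrite size_sort size_enum_ord.
have uo : uniq (ord r) by rewrite sort_uniq enum_uniq.
have := sum_walk_exceeds uo t0; rewrite so -/beta card_ffun card_bool card_ord.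
rewrite natrX => hs.
have -> : \sum_s (if Q (r, s) then 2^-1 ^+ n * p r else 0) = 2^-1 ^+ n * p r *
    \sum_(s : {ffun 'I_n -> bool})
      (has (walk_exceeds t [seq s i | i <- ord r]) (iota 1 n))%:R.
  rewrite mulr_sumr; apply: eq_bigr => s _; rewrite {1}/Q /=.
  by case: ifP => _; rewrite ?mulr1 ?mulr0.
(* The number [2 ^ n] of sign patterns cancels the weight [2^-1 ^+ n] of each. *)
apply: (le_trans (ler_wpM2l (mulr_ge0 c0 p0) hs)).
rewrite mulrA [2^-1 ^+ n * _]mulrC -[p r * _ * _]mulrA -exprMn mulVf //.
by rewrite expr1n mulr1.
Qed.

End symmetric_null.

(** * The alternative *)

(** A three-valued summary of an observation, to which [iid_markov] applies; it determines both the
    count and the sign sum beyond the level [x]. *)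
Definition tail_sign (R : realType) (x y : R) : option bool :=
  if x < y then Some true else if y < - x then Some false else None.

Definition tail_value (R : realType) (a : option bool) : R :=
  if a is Some b then pm1 R b else 0.

Lemma tail_sign_sg (R : realType) (x y : R) : 0 <= x ->
  (tail_value R (tail_sign x y) = if x < `|y| then Num.sg y else 0) /\
  (tail_sign x y != None) = (x < `|y|).
Proof.
move=> x0; rewrite /tail_sign lter_normr [x < - y]ltrNr.
have [xy|yx] /= := ltP x y; first by rewrite /= gtr0_sg //; exact: le_lt_trans xy.
have [yx'|_] //= := ltP y (- x).
by rewrite /= ltr0_sg //; apply: (lt_le_trans yx'); rewrite oppr_le0.
Qed.

Lemma big_option_bool (R : nmodType) (f : option bool -> R) :
  \sum_a f a = f (Some true) + f (Some false) + f None.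
Proof.
rewrite (bigD1 (Some true)) // (bigD1 (Some false)) //= (bigD1 None) //=.
by rewrite big1 ?addr0 ?addrA //; case=> [[]|].
Qed.

Section alternative.
Variables (R : realType) (H : R -> R).
Hypothesis (cH : continuous H).
Variables (d : measure_display) (T : measurableType d) (P : probability T R).
Variables (n : nat) (X : 'I_n -> {RV P >-> R}).
Hypotheses (n0 : (0 < n)%N) (iidX : iid_with_cdf X H).
Variable x : R.
Hypothesis x0 : 0 <= x.

Let prb (a : option bool) : R :=
  match a with
  | Some true => 1 - H x
  | Some false => H (- x)
  | None => H x - H (- x)
  end.

(** The probability that an observation exceeds [x] in absolute value; [Delta] below is the mean of
    its [tail_value]. *)
Let q := (1 - H x) + H (- x).
Let Delta := (1 - H x) - H (- x).

Let tail_sign_preimage a : tail_sign x @^-1` [set a] =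
  match a with
  | Some true => `]x, +oo[%classic
  | Some false => `]-oo, (- x)[%classic
  | None => `[- x, x]%classic
  end.
Proof.
apply/seteqP; split => y; rewrite /preimage /tail_sign /=.
  have [xy|yx] := ltP x y; first by move=> <- /=; rewrite in_itv /= xy.
  have [yx'|yx'] := ltP y (- x); move=> <- /=; rewrite in_itv //=.
  by rewrite yx yx'.
case: a => [[]|] /=; rewrite in_itv /=.
- by rewrite andbT => ->.
- move=> yx; have yx' : y <= x.
    by rewrite (le_trans (ltW yx)) // (le_trans _ x0) // oppr_le0.
  by rewrite yx ltNge yx'.
- by move=> /andP[h1 h2]; rewrite !ltNge h1 h2.
Qed.

Let mtail a : measurable (tail_sign x @^-1` [set a]).
Proof. by rewrite tail_sign_preimage; case: a => [[]|]; exact: measurable_itv. Qed.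

Let prbE i a : P (X i @^-1` (tail_sign x @^-1` [set a])) = (prb a)%:E.
Proof.
have [_ cdfX] := iidX; rewrite tail_sign_preimage; case: a => [[]|] /=.
- exact: probability_gt (cdfX i) _.
- exact: (probability_lt (cdfX i) cH).
- by apply: (probability_itvcc (cdfX i) cH); rewrite (le_trans _ x0) // oppr_le0.
Qed.

Let msum (g : option bool -> R) (Q : set R) :
  measurable [set w | Q (\sum_i g (tail_sign x (X i w)))].
Proof.
have -> : [set w | Q (\sum_i g (tail_sign x (X i w)))] =
    [set w | [set z : {ffun 'I_n -> option bool} | Q (\sum_i g (z i))]
      [ffun i => tail_sign x (X i w)]].
  apply/funext => w /=; congr (Q _).
  by apply: eq_bigr => i _; rewrite ffunE.
apply: (@measurable_ffun_preimage _ _ _ _ (fun i w => tail_sign x (X i w))).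
move=> i a; have := measurable_funPT (X i) measurableT _ (mtail a).
by rewrite setTI.
Qed.

Let prb_ge0 a : 0 <= prb a.
Proof. by rewrite -lee_fin -(prbE (Ordinal n0)) measure_ge0. Qed.

(** A Chernoff bound for the sign sum falling to half its mean [n%:R * Delta]. Since [Delta <= q],
    the parameter [l] is small enough for [expR_le_quadratic]. *)
Lemma tail_sum_deviation : 0 < Delta ->
  (P [set w | (\sum_i tail_value R (tail_sign x (X i w)) <=
               n%:R * (Delta / 2))%R] <=
   (expR (- (n%:R * (Delta ^+ 2 / (32 * q)))))%:E)%E.
Proof.
move=> D0; have [indX _] := iidX.
have pp := prb_ge0 (Some true); have pm := prb_ge0 (Some false).
rewrite /= in pp pm.
have Dq : Delta <= q by rewrite /q /Delta; lra.
have q0 : 0 < q by lra.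
(* The minimizer of the exponent [- l Delta / 2 + 2 l^2 q]. *)
pose l := Delta / (8 * q).
have l0 : 0 <= l by rewrite divr_ge0 //; lra.
have l1 : l <= 1 / 2 by rewrite /l ler_pdivrMr; lra.
pose w (a : option bool) := expR (l * (Delta / 2 - tail_value R a)).
apply: le_trans.
  apply: (iid_markov (p := prb) (w := w) indX mtail prbE).
  - by move=> a; exact: expR_ge0.
  - exact: (msum (tail_value R) [set u | u <= n%:R * (Delta / 2)]).
  - move=> v /= Dv; rewrite -expR_sum -[leLHS]expR0 ler_expR -mulr_sumr.
    by rewrite mulr_ge0 // sumrB sumr_const card_ord -[_ *+ n]mulr_natl subr_ge0.
rewrite card_ord lee_fin -mulrN expRM_natl ler_pXn2r ?nnegrE ?expR_ge0 //;
  last by apply: sumr_ge0 => a _; rewrite mulr_ge0 ?expR_ge0.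
rewrite big_option_bool /w /= subr0.
have -> : expR (l * (Delta / 2 - 1)) = expR (l * (Delta / 2)) * expR (- l).
  by rewrite -expRD; congr expR; ring.
have -> : expR (l * (Delta / 2 - -1)) = expR (l * (Delta / 2)) * expR l.
  by rewrite -expRD; congr expR; ring.
have e1 := expR_le_quadratic l1.
have e2 : expR (- l) <= 1 + - l + 2 * (- l) ^+ 2.
  by apply: expR_le_quadratic; lra.
rewrite sqrrN in e2.
have h1 := ler_wpM2l pp e2.
have h2 := ler_wpM2l pm e1.
have h3 := expR_ge1Dx (- (l * Delta) + 2 * l ^+ 2 * q).
(* In the quadratic bounds the linear terms add up to [- (l * Delta)] and the quadratic ones to
   [2 * l ^+ 2 * q]; then [1 + y <= expR y]. *)
apply: (@le_trans _ _ (expR (l * (Delta / 2)) *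
    expR (- (l * Delta) + 2 * l ^+ 2 * q))).
  rewrite [leLHS](_ : _ = expR (l * (Delta / 2)) * ((1 - H x) * expR (- l)
    + H (- x) * expR l + (H x - H (- x)))); last by ring.
  rewrite ler_wpM2l ?expR_ge0 //; apply: (le_trans _ h3).
  rewrite /q /Delta in h1 h2 *; lra.
rewrite -expRD ler_expR le_eqVlt; apply/orP; left; apply/eqP.
rewrite /l; field; exact: lt0r_neq0.
Qed.

(** The count has mean [n%:R * q]. The Chernoff parameter is fixed at 1/2: as [expR (1 / 2) <= 2],
    each factor is at most [expR (- (2 * q)) * (1 + q)], hence at most [expR (- q)]. *)
Lemma tail_count_deviation : 
  (P [set w | (n%:R * (4 * q) <= \sum_i (tail_sign x (X i w) != None)%:R)%R] <=
   (expR (- (n%:R * q)))%:E)%E.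
Proof.
have [indX _] := iidX.
have pp := prb_ge0 (Some true); have pm := prb_ge0 (Some false).
rewrite /= in pp pm.
have q0 : 0 <= q by rewrite /q; lra.
pose w (a : option bool) : R := expR (1 / 2 * (a != None)%:R - 2 * q).
apply: le_trans.
  apply: (iid_markov (p := prb) (w := w) indX mtail prbE).
  - by move=> a; exact: expR_ge0.
  - exact: (msum (fun a => (a != None)%:R) [set u | n%:R * (4 * q) <= u]).
  - move=> v /= Dv; rewrite -expR_sum -[leLHS]expR0 ler_expR.
    rewrite sumrB sumr_const card_ord -[_ *+ n]mulr_natl -mulr_sumr; lra.
rewrite card_ord lee_fin -mulrN expRM_natl ler_pXn2r ?nnegrE ?expR_ge0 //;
  last by apply: sumr_ge0 => a _; rewrite mulr_ge0 ?expR_ge0.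
rewrite big_option_bool /w /= mulr1 mulr0 sub0r expRD.
have e1 : expR (1 / 2) <= 1 + 1 / 2 + 2 * (1 / 2) ^+ 2 :> R.
  exact: expR_le_quadratic.
have e2 := ler_wpM2l q0 e1.
have e3 := expR_ge1Dx q.
have -> : expR (- q) = expR (- (2 * q)) * expR q.
  by rewrite -expRD; congr expR; ring.
rewrite [leLHS](_ : _ = expR (- (2 * q)) * (q * expR (1 / 2) + (1 - q))); last first.
  by rewrite /q; ring.
rewrite ler_wpM2l ?expR_ge0 //; apply: (le_trans _ e3); lra.
Qed.

(** Outside the two deviation events the sign sum exceeds [n%:R * (Delta / 2)] and the count is
    below [n%:R * (4 * q)], so their ratio at the level [x] beats [t]. *)
Lemma cusum_sign_alternative_tail (t : R) : 0 < Delta -> 0 <= t ->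
  t * Num.sqrt (n%:R * (4 * q)) <= n%:R * (Delta / 2) ->
  (P [set w | (cusum_sign [seq X i w | i <- enum 'I_n] <= t)%R] <=
   (expR (- (n%:R * (Delta ^+ 2 / (32 * q)))) + expR (- (n%:R * q)))%:E)%E.
Proof.
move=> D0 t0 ht; rewrite EFinD.
apply: (le_trans _ (leeD (tail_sum_deviation D0) tail_count_deviation)).
have mD := msum (tail_value R) [set u | u <= n%:R * (Delta / 2)].
have mK := msum (fun a => (a != None)%:R) [set u | n%:R * (4 * q) <= u].
apply: (le_trans _ (measureU2 _ mD mK)).
apply: le_measure; rewrite ?inE.
- apply: (@measurable_cusum_sign _ _ _ _ (fun i => X i : T -> R)
    [set m | m <= t]) => i; exact: measurable_funPT.
- exact: measurableU.
move=> w /= Mt; apply: contrapT => /not_orP[/negP D1 /negP K1].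
move: Mt; apply/negP; rewrite -ltNge.
apply: (@lt_cusum_sign_threshold _ _ (fun i => X i w) x).
have -> : \sum_(i < n | x < `|X i w|) Num.sg (X i w) =
    \sum_i tail_value R (tail_sign x (X i w)).
  rewrite big_mkcond; apply: eq_bigr => i _.
  by have [->] := tail_sign_sg (X i w) x0.
have -> : \sum_(i < n) (x < `|X i w|)%R%:R =
    \sum_i (tail_sign x (X i w) != None)%:R :> R.
  apply: eq_bigr => i _.
  by have [_ ->] := tail_sign_sg (X i w) x0.
move: D1 K1; rewrite -!ltNge => D1 K1.
apply: (le_lt_trans _ D1); apply: (le_trans _ ht).
by rewrite ler_wpM2l // ler_wsqrtr // ltW.
Qed.

End alternative.

(** * Asymptotics *)

Lemma cumulativeBounded01 (R : realType) (G : cumulativeBounded (0 : R) (1 : R))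
    (x : R) : 0 <= G x <= 1.
Proof.
have nd := cumulative_is_nondecreasing G; apply/andP; split.
  apply: (cvgr_to_le (cumulativeNy G)).
  near=> y; apply: nd; near: y; exact: nbhs_ninfty_le (num_real x).
apply: (cvgr_to_ge (cumulativey G)).
near=> y; apply: nd; near: y; exact: nbhs_pinfty_ge (num_real x).
Unshelve. all: by end_near. Qed.

Lemma continuous_mixture_cdf (R : realType) (F G : R -> R) (eps mu : R) :
  continuous F -> continuous G -> continuous (mixture_cdf F G eps mu).
Proof.
move=> cF cG y; apply: cvgD; apply: cvgM; try exact: cvg_cst; first exact: cF.
apply: (@cvg_comp _ _ _ (fun x => x - mu) G); last exact: cG.
by apply: cvgB; [exact: cvg_id|exact: cvg_cst].
Qed.

(** The signal [a] is normalized by an upper bound [W], so that one statement serves both conditions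
    of the theorem. By symmetry [F] cancels from the mean [D], while [D <= q <= 2 * W]. *)
Lemma mixture_tail (R : realType) (F G : cumulativeBounded (0 : R) (1 : R))
    (eps mu : R) (d : measure_display) (T : measurableType d)
    (P : probability T R) (n : nat) (X : 'I_n -> {RV P >-> R}) (x W a t : R) :
  continuous F -> (forall x, F (- x) = 1 - F x) -> continuous G ->
  0 < eps <= 1 -> (0 < n)%N -> iid_with_cdf X (mixture_cdf F G eps mu) ->
  0 <= x ->
  1 - F x + eps * (1 - G (x - mu) + G (- x - mu)) <= W ->
  a = Num.sqrt n%:R * eps * (1 - G (x - mu) - G (- x - mu)) / Num.sqrt W ->
  0 < a -> 0 <= t -> 8 * t <= a ->
  (P [set w | (cusum_sign [seq X i w | i <- enum 'I_n] <= t)%R] <=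
   (2 * expR (- (a ^+ 2 / 64)))%:E)%E.
Proof.
move=> cF symF cG /andP[eps0 eps1] n0 iidX x0 VW aE a0 t0 ta.
set D := eps * (1 - G (x - mu) - G (- x - mu)).
set H := mixture_cdf F G eps mu.
have [F0 F1] := andP (cumulativeBounded01 F x).
have [G0 G1] := andP (cumulativeBounded01 G (x - mu)).
have [G0' G1'] := andP (cumulativeBounded01 G (- x - mu)).
have DE : 1 - H x - H (- x) = D by rewrite /H /mixture_cdf symF /D; ring.
set q := 1 - H x + H (- x).
have qE : q = 2 * (1 - eps) * (1 - F x) +
    eps * (1 - G (x - mu) + G (- x - mu)).
  by rewrite /q /H /mixture_cdf symF; ring.
have n0' : (0 : R) < n%:R by rewrite ltr0n.
pose r : R := Num.sqrt n%:R; pose v := Num.sqrt W.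
have r0 : 0 < r by rewrite sqrtr_gt0.
have v0 : 0 < v.
  (* Division by zero yields 0, so [0 < a] forces [W] to be positive. *)
  rewrite lt0r sqrtr_ge0 andbT; apply/eqP => v0.
  by move: a0; rewrite aE -/v v0 invr0 mulr0 ltxx.
have W0 : 0 < W by rewrite -sqrtr_gt0.
have aE' : a * v = r * D.
  by rewrite aE /D -/r -/v; field; exact: lt0r_neq0.
have D0 : 0 < D by rewrite -(pmulr_rgt0 _ r0) -aE' mulr_gt0.
have Dq : D <= q.
  have : 0 <= 2 * (1 - eps) * (1 - F x) by rewrite !mulr_ge0 //; lra.
  have : 0 <= eps * G (- x - mu) by rewrite mulr_ge0 // ltW.
  rewrite qE /D; lra.
have qW : q <= 2 * W.
  have : 0 <= eps * (1 - F x) by rewrite mulr_ge0 ?(ltW eps0) //; lra.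
  have : 0 <= eps * (1 - G (x - mu) + G (- x - mu)).
    by rewrite mulr_ge0 ?(ltW eps0) //; lra.
  rewrite qE; lra.
have q0 : 0 < q by lra.
have vW : v ^+ 2 = W by rewrite sqr_sqrtr // ltW.
have rn : r ^+ 2 = n%:R by rewrite sqr_sqrtr // ltW.
have a2 : a ^+ 2 * W = n%:R * D ^+ 2 by rewrite -vW -rn -!exprMn aE'.
have e1 : a ^+ 2 / 64 <= n%:R * (D ^+ 2 / (32 * q)).
  rewrite mulrA -a2 ler_pdivlMr; last by lra.
  have := ler_wpM2l (sqr_ge0 a) qW; lra.
(* From [D <= q] and [q <= 2 * W]: [n q^2 >= n D^2 = a^2 W >= a^2 q / 2]. *)
have e2 : a ^+ 2 / 64 <= n%:R * q.
  have h1 : D ^+ 2 <= q ^+ 2 by rewrite ler_pXn2r ?nnegrE // ltW.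
  have h2 := ler_wpM2l (ltW n0') h1.
  have h3 := ler_wpM2l (sqr_ge0 a) qW.
  rewrite -(ler_pM2r q0).
  have h4 : 0 <= n%:R * q ^+ 2 by rewrite mulr_ge0 ?sqr_ge0 // ltW.
  lra.
have ht : t * Num.sqrt (n%:R * (4 * q)) <= n%:R * (D / 2).
  (* Here [4 q <= 8 W <= 9 W]; with [t <= a / 8] the product is at most [3/8] of [n D], below the
     required half. *)
  have h1 : Num.sqrt (n%:R * (4 * q)) <= 3 * (r * v).
    rewrite -(@ger0_norm _ (3 * (r * v))); last by rewrite !mulr_ge0 // ltW.
    rewrite -sqrtr_sqr ler_sqrt ?sqr_ge0 // !exprMn rn vW mulrCA ler_pM2l //.
    lra.
  have rv0 : 0 < r * v by rewrite mulr_gt0.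
  apply: (le_trans (ler_wpM2l t0 h1)).
  have h2 := ler_wpM2r (ltW rv0) ta.
  have h3 : a * (r * v) = n%:R * D by rewrite mulrCA aE' mulrA -expr2 rn.
  have h4 : 0 < n%:R * D by rewrite mulr_gt0.
  lra.
have cH : continuous H by exact: continuous_mixture_cdf.
have := @cusum_sign_alternative_tail _ _ cH _ _ _ _ _ n0 iidX x x0 t.
rewrite -/q DE => /(_ D0 t0 ht) /le_trans; apply.
by rewrite lee_fin [leRHS]mulr_natl mulr2n lerD // ler_expR lerN2.
Qed.

(** The exponent is [36/16 >= 2] times the iterated logarithm, so the exponential is at most
    [(ln n)^-2], against a number of blocks of order [ln n]. *)
Lemma null_rate (R : realType) (n : nat) : 1 <= ln (n%:R : R) ->
  (trunc_log 2 n).+1%:R *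
    expR (- ((6 * Num.sqrt (ln (ln (n%:R : R)))) ^+ 2 / 16))
  <= ((ln 2)^-1 + 1) / ln (n%:R : R).
Proof.
set L := ln _ => L1.
have L0 : 0 < L by lra.
have n0 : (0 < n)%N by case: n @L L1 L0 => // L L1; rewrite /L ln0 // ltxx.
have n0' : (0 : R) < n%:R by rewrite ltr0n.
have ll0 : 0 <= ln L by exact: ln_ge0.
have l2 : 0 < ln (2 : R) by apply: ln_gt0; lra.
have hJ : (trunc_log 2 n).+1%:R <= ((ln 2)^-1 + 1) * L.
  rewrite -natr1 mulrDl mul1r lerD // mulrC ler_pdivlMr //.
  have -> : (trunc_log 2 n)%:R * ln 2 = ln (2 ^+ trunc_log 2 n) :> R.
    by rewrite lnXn // mulr_natl.
  by rewrite ler_ln ?posrE ?exprn_gt0 // -natrX ler_nat trunc_logP.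
have he : expR (- ((6 * Num.sqrt (ln L)) ^+ 2 / 16)) <= L^-1 ^+ 2.
  apply: (@le_trans _ _ (expR (- (ln L *+ 2)))).
    by rewrite ler_expR exprMn sqr_sqrtr // lerN2 -mulr_natl; lra.
  by rewrite expRN -lnXn // lnK ?posrE ?exprn_gt0 // exprVn.
apply: (le_trans (ler_pM _ (expR_ge0 _) hJ he)) => //.
rewrite expr2 mulrA -[_ * L * _]mulrA divff ?lt0r_neq0 // mulr1 //.
Qed.

Lemma nbhs_infty_ln_ger (R : realType) (M : R) :
  \forall n \near \oo, M <= ln (n%:R : R).
Proof.
near=> n.
have h : expR M <= n%:R by near: n; exact: nbhs_infty_ger.
by rewrite -ler_expR lnK // posrE (lt_le_trans _ h) ?expR_gt0.
Unshelve. all: by end_near. Qed.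

(** * Total variation distance between the two laws of a statistic *)

Section total_variation.
Variables (R : realType) (d d' : measure_display) (T : measurableType d).
Variables (U : measurableType d') (P Q : probability T R) (S : T -> U).
Hypothesis mS : forall A, measurable A -> measurable (S @^-1` A).

Let dist A := `|fine (pushforward P S A) - fine (pushforward Q S A)|.

Let dist_le1 A : measurable A -> dist A <= 1.
Proof.
move=> /mS mA; rewrite /dist /pushforward.
have h (P' : probability T R) : 0 <= fine (P' (S @^-1` A)) <= 1.
  rewrite fine_ge0 //= -lee_fin fineK ?probability_le1 //.
  exact: fin_num_measure.
have := h P; have := h Q.
by move=> /andP[h1 h2] /andP[h3 h4]; rewrite ler_norml; apply/andP; split; lra.
Qed.

Lemma total_variation_dist_le2 :
  total_variation_dist (pushforward P S) (pushforward Q S) <= 2.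
Proof.
rewrite /total_variation_dist -[leRHS]mulr1 ler_wpM2l //.
apply: sup_le_ub; first by exists (dist set0), set0.
by move=> _ [A mA <-]; exact: dist_le1.
Qed.

Lemma total_variation_dist_ge (A : set U) : measurable A ->
  2 * (fine (Q (S @^-1` A)) - fine (P (S @^-1` A))) <=
  total_variation_dist (pushforward P S) (pushforward Q S).
Proof.
move=> mA; rewrite /total_variation_dist ler_wpM2l //.
apply: (@le_trans _ _ (dist A)); first by rewrite /dist distrC ler_norm.
apply: sup_upper_bound; last by exists A.
split; first by exists (dist A), A.
by exists 1 => _ [B mB <-]; exact: dist_le1.
Qed.

End total_variation.

Unset Implicit Arguments.
Set Strict Implicit.
Set Printing Implicit Defensive.

Theorem proposition2 (R : realType) (F G : cumulativeBounded (0 : R) (1 : R))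
    (F_continuous : continuous F)
    (F_symmetric : forall x : R, F (- x) = 1 - F x)
    (G_continuous : continuous G)
    (G_median0 : G 0 = 1 / 2)
    (eps mu : nat -> R)
    (eps_itv : forall n, 0 < eps n <= 1)
    (eps_cvg0 : eps @ \oo --> (0 : R))
    (mu_gt0 : forall n, 0 < mu n)
    (d : nat -> measure_display) (T : forall n, measurableType (d n))
    (P0 P1 : forall n, probability (T n) R)
    (X : forall n, 'I_n -> {mfun T n >-> R})
    (H0 : forall n, iid_with_cdf (P := P0 n) (X n) F)
    (H1 : forall n, iid_with_cdf (P := P1 n) (X n)
                      (mixture_cdf F G (eps n) (mu n))) :
  let Fbar x := 1 - F x in
  let Gbar x := 1 - G x in
  let sqrt_loglog n := Num.sqrt (ln (ln n%:R)) : R in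
  much_larger (fun n => Num.sqrt n%:R * eps n * (1 / 2 - G (- mu n)))
              sqrt_loglog
  \/
  (exists x : nat -> R,
     much_larger
       (fun n => Num.sqrt n%:R * eps n
                   * (Gbar (x n - mu n) - G (- x n - mu n))
                 / Num.sqrt (Fbar (x n)
                     + eps n * (Gbar (x n - mu n) + G (- x n - mu n))))
       sqrt_loglog) ->
  asymptotically_powerful P0 P1
    (fun n w => cusum_sign [seq X n i w | i <- enum 'I_n]).
Proof.
move=> Fbar Gbar sqrt_loglog signal.
(* Both conditions are brought to the form of [mixture_tail], with a nonnegative level. *)
have [x [W [a [x0 VW aE [a_gt0 _ llo_a]]]]] : exists x W a : nat -> R,
    [/\ forall n, 0 <= x n,
        forall n, 1 - F (x n) + eps n * (1 - G (x n - mu n) + G (- x n - mu n))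
          <= W n,
        forall n, a n = Num.sqrt n%:R * eps n *
          (1 - G (x n - mu n) - G (- x n - mu n)) / Num.sqrt (W n) &
        much_larger a sqrt_loglog].
  case: signal => [signal|[x signal]].
    (* At level 0 the bracket is [2 * (1/2 - G (- mu n))]; the choice [W = 4] divides by 2 and
       dominates [1/2 + eps n]. *)
    exists (fun=> 0), (fun=> 2 ^+ 2); eexists; split; last exact: signal.
    + by [].
    + move=> n; have [e0 e1] := andP (eps_itv n).
      have := F_symmetric 0; rewrite !oppr0 sub0r => F0.
      by rewrite subrK mulr1; lra.
    + by move=> n; rewrite oppr0 sub0r sqrtr_sqr normr_nat; field.
  (* Changing the sign of a negative [x n] preserves the numerator and can only lower the quantity
     under the root, so the original denominator remains a valid [W]. *)
  exists (fun n => `|x n|); eexists; eexists; split; last exact: signal.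
  - by [].
  - move=> n; have [e0 e1] := andP (eps_itv n); rewrite /Fbar /Gbar.
    case: ger0P => [_|xn]; first exact: lexx.
    have ndF := cumulative_is_nondecreasing F.
    have ndG := cumulative_is_nondecreasing G.
    have h1 : F (x n) <= F (- x n) by apply: ndF; lra.
    have h2 : G (x n - mu n) <= G (- x n - mu n) by apply: ndG; lra.
    rewrite opprK lerD //; first by lra.
    by rewrite ler_wpM2l ?(ltW e0) //; lra.
  - move=> n /=; rewrite /Gbar; congr (_ * _ / _).
    by case: ger0P => // _; rewrite opprK; ring.
(* The constant [(ln 2)^-1 + 1] of [null_rate] plus the 2 of [mixture_tail]. *)
pose C : R := (ln 2)^-1 + 3.
have C0 : 0 < C.
  by rewrite ltr_wpDl // invr_ge0 ln_ge0 //; lra.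
have mM n (A : set R) : measurable A ->
    measurable ((fun w => cusum_sign [seq X n i w | i <- enum 'I_n]) @^-1` A).
  move=> _; apply: (@measurable_cusum_sign _ _ _ _ (fun i => X n i : T n -> R)).
  by move=> i; exact: measurable_funPT.
(* 48 is 8 times 6: this gives [8 * t <= a n] for the threshold [t] below. *)
have ll_a : \forall n \near \oo, sqrt_loglog n / a n < 48^-1.
  by apply: (cvgr_lt _ llo_a); rewrite invr_gt0.
apply/cvgrPdist_le => e e0; near=> n.
have L1 : 1 <= ln (n%:R : R) by near: n; exact: nbhs_infty_ln_ger.
have Le : 2 * C / e <= ln (n%:R : R) by near: n; exact: nbhs_infty_ln_ger.
have an : 0 < a n by near: n; exact: a_gt0.
have lla : sqrt_loglog n / a n < 48^-1.
  by near: n; exact: ll_a.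
set L := ln _ in L1 Le.
have L0 : 0 < L by lra.
have n0 : (0 < n)%N.
  by rewrite lt0n; apply/eqP => n0; move: L0; rewrite /L n0 ln0 // ltxx.
have ll0 : 0 <= ln L by exact: ln_ge0.
pose t := 6 * sqrt_loglog n.
have t0 : 0 <= t by rewrite mulr_ge0 ?sqrtr_ge0.
have ta : 8 * t <= a n by move: lla; rewrite ltr_pdivrMr // /t; lra.
have p0 := cusum_sign_null_tail F_continuous F_symmetric (H0 n) n0 t0.
have r0 := null_rate L1.
have p1 := mixture_tail F_continuous F_symmetric G_continuous (eps_itv n) n0
  (H1 n) (x0 n) (VW n) (aE n) an t0 ta.
have eL : expR (- (a n ^+ 2 / 64)) <= L^-1.
  have h : (8 * t) ^+ 2 <= a n ^+ 2.
    have t8 : 0 <= 8 * t by rewrite mulr_ge0.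
    by rewrite ler_pXn2r ?nnegrE // ltW.
  have h2 : t ^+ 2 = 36 * ln L by rewrite /t exprMn sqr_sqrtr //; ring.
  have -> : L^-1 = expR (- ln L) by rewrite expRN lnK.
  rewrite ler_expR; rewrite exprMn h2 in h; lra.
have lo := total_variation_dist_ge (P0 n) (P1 n) (mM n)
  (measurable_itv `]t, +oo[).
have hi := total_variation_dist_le2 (P0 n) (P1 n) (mM n).
(* The distance is at most 2, and the rejection region shows that it falls short of 2 by at most
   twice the sum of the two error probabilities. *)
rewrite ger0_norm ?subr_ge0 //; apply: (@le_trans _ _ (2 * C / L)); last first.
  by move: Le; rewrite !ler_pdivrMr // [e * _]mulrC.
pose M w := cusum_sign [seq X n i w | i <- enum 'I_n].
have fin (P : probability (T n) R) (A : set R) : measurable A ->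
    P (M @^-1` A) \is a fin_num.
  by move=> mA; exact: fin_num_measure (mM n A mA).
have gtE : M @^-1` `]t, +oo[ = [set w | t < M w].
  by apply/seteqP; split => w /=; rewrite in_itv /= andbT.
have leE : M @^-1` `]-oo, t] = [set w | M w <= t].
  by apply/seteqP; split => w /=; rewrite in_itv.
have {}p0 : fine (P0 n (M @^-1` `]t, +oo[)) <= ((ln 2)^-1 + 1) / L.
  rewrite -lee_fin fineK ?fin // gtE.
  by apply: (le_trans p0); rewrite lee_fin.
have {}p1 : fine (P1 n (M @^-1` `]-oo, t])) <= 2 * L^-1.
  rewrite -lee_fin fineK ?fin // leE.
  by apply: (le_trans p1); rewrite lee_fin ler_pM2l.
have e1 : fine (P1 n (M @^-1` `]t, +oo[)) = 1 - fine (P1 n (M @^-1` `]-oo, t])).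
  rewrite -setCitvl -preimage_setC probability_setC; last exact: mM.
  by rewrite fineB ?fin.
move: lo; rewrite -/M e1 /C => lo; lra.
Unshelve. all: by end_near. Qed.
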